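(* Let $N$ and $j$ be positive integers. Then $$ j!\,2^N \binom{N+j-1}{j}\; {}_2F_1\left(\begin{matrix}-j,\,-2j \\ -N-j+1 \end{matrix};-1\right) = \sum_{l=0}^N \binom{N}{l}\prod_{i=0}^{j-1}2(2i+1+l). $$
   Context: For $n\geq 1$ the rising factorial is $(a)^{\overline n} := a(a+1)\cdots(a+n-1)$, and $(a)^{\overline 0}:=1$. The Gauss hypergeometric function with upper parameter $-j$ is the terminating sum $$ {}_2F_1\left(\begin{matrix}-j,\,b \\ c \end{matrix};z\right) = \sum_{k=0}^{j} \frac{(-j)^{\overline k}\,(b)^{\overline k}}{(c)^{\overline k}}\,\frac{z^k}{k!}. $$ For $c=-N-j+1$ with $N\ge 1$, the denominators $(c)^{\overline k}$, $0\le k\le j$, are all nonzero. *)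

(* Defs.v *)
From mathcomp Require Import all_boot all_order all_algebra.

Set Implicit Arguments.
Unset Strict Implicit.
Unset Printing Implicit Defensive.

Import GRing.Theory.
Local Open Scope ring_scope.

Definition rising (F : fieldType) (a : F) (n : nat) : F :=
  \prod_(0 <= i < n) (a + i%:R).

(* The terminating Gauss series 2F1(-j, b; c; z), for z in F.  As x / 0 = 0 in
   MathComp, this is meaningful only when rising c k != 0 for all k <= j (and
   F has characteristic 0 or greater than j). *)
Definition gauss2F1 (F : fieldType) (j : nat) (b c z : F) : F :=
  \sum_(0 <= k < j.+1)
    rising (- j%:R) k * rising b k / rising c k * (z ^+ k / k`!%:R).

(* Main.v *)
Require Import Defs.
From mathcomp Require Import all_boot all_order all_algebra.
From mathcomp Require Import ring zify.

Import GRing.Theory Num.Theory.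
Local Open Scope ring_scope.

(** Write [x^n] f for the coefficient of x^n in f.  Clearing denominators, the
    left-hand side is j! 2^N [x^j] (1+x)^(2j) (1-x)^(-N).  More generally, for
    every a,
      sum_l C(N,l) prod_(i<j) 2(2i+1+a+l)
        = j! 2^N [x^j] (1+x)^(2j+a) (1-x)^(-N-a).
    The identity 1 + (1+x)/(1-x) = 2/(1-x) gives the induction step on N.  For
    N = 0, differentiating f = (1+x)^(2j+2+a) (1-x)^(-a) and using that
    [x^j] (x h' - j h) = 0 with h = (1+x)^(2j+2+a) (1-x)^(-a-1) gives
      (j+1) [x^(j+1)] f = 2(a+1) [x^j] (1+x)^(2j+2+a) (1-x)^(-a-2),
    which is an induction on j with a replaced by a + 2. *)

(* The coefficient of x^n in (1-x)^(-m); the truncated predecessor gives the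
   right values 1, 0, 0, ... also for m = 0. *)
Definition multichoose (m n : nat) : nat := 'C((m + n).-1, n).

(* The coefficient of x^n in (1+x)^p (1-x)^(-m). *)
Definition mixcoef (p m n : nat) : nat :=
  (\sum_(0 <= k < n.+1) 'C(p, k) * multichoose m (n - k))%N.

Lemma multichoose0 m : multichoose m 0 = 1%N.
Proof. by rewrite /multichoose bin0. Qed.

Lemma multichooseS m n :
  multichoose m.+1 n.+1 = (multichoose m.+1 n + multichoose m n.+1)%N.
Proof. by rewrite /multichoose !addSn !addnS /= binS addnC. Qed.

Lemma mul_multichoose m n :
  (n.+1 * multichoose m n.+1 = m * multichoose m.+1 n)%N.
Proof.
rewrite /multichoose addnS addSn /=; case: m => [|m].
  by rewrite add0n bin_small ?muln0.
by rewrite mul_bin_left addSn; congr (_ * _)%N; lia.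
Qed.

Lemma mixcoef_small p m : mixcoef p m 0 = 1%N.
Proof. by rewrite /mixcoef big_nat1 bin0 multichoose0. Qed.

Lemma mixcoef0 m n : mixcoef 0 m n = multichoose m n.
Proof.
by rewrite /mixcoef big_nat_recl // bin0 mul1n subn0 big1 ?addn0 //.
Qed.

(** Multiplication of the series by [1 + x]. *)
Lemma mixcoefSl p m n :
  mixcoef p.+1 m n.+1 = (mixcoef p m n.+1 + mixcoef p m n)%N.
Proof.
rewrite /mixcoef big_nat_recl // [in RHS]big_nat_recl // !bin0 -addnA.
congr (_ + _)%N; rewrite -big_split /=.
by apply: eq_bigr => k _; rewrite binS mulnDl subSS.
Qed.

(** From (1-x)^(-m-1) = x (1-x)^(-m-1) + (1-x)^(-m). *)
Lemma mixcoefSr p m n :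
  mixcoef p m.+1 n.+1 = (mixcoef p m.+1 n + mixcoef p m n.+1)%N.
Proof.
rewrite /mixcoef big_nat_recr // [X in (_ + X)%N]big_nat_recr //=.
rewrite subnn !multichoose0 addnA; congr (_ + _)%N; rewrite -big_split /=.
by apply: eq_big_nat => k /andP[_ lekn]; rewrite subSn // multichooseS mulnDr.
Qed.

(** The product rule for (1+x)^p (1-x)^(-m), read at x^n; at [p = 0] the truncated [p.-1] is
    harmless, its factor being 0. *)
Lemma mixcoef_deriv p m n :
  (n.+1 * mixcoef p m n.+1 =
   p * mixcoef p.-1 m n + m * mixcoef p m.+1 n)%N.
Proof.
elim: p n => [|p IHp] n; first by rewrite !mixcoef0 mul_multichoose.
rewrite mixcoefSl mulnDr IHp /=; case: n => [|n].
  by rewrite !mixcoef_small; lia.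
have := IHp n; case: p {IHp} => [|p] /=; rewrite !(mixcoefSl _ _ n); lia.
Qed.

Lemma mixcoef_central a j :
  (j.+1 * mixcoef (j.+1.*2 + a) a j.+1 =
   2 * a.+1 * mixcoef (j.*2 + a.+2) a.+2 j)%N.
Proof.
rewrite mixcoef_deriv doubleS !addSn !addnS /=; set q := (j.*2 + a).+1.
have qE : q = (j.*2 + a).+1 by [].
case: j @q qE => [|n] q qE; first by rewrite !mixcoef_small; lia.
(* With j = [n.+1], [dh] says [x^j] (x h' - j h) = 0 for h = (1+x)^(q+1) (1-x)^(-a-1). *)
have := mixcoef_deriv q.+1 a.+1 n; rewrite /= => dh.
case: n q qE dh => [|n] q qE.
  have := mixcoefSl q a.+1 0; have := mixcoefSl q a.+2 0.
  have := mixcoefSr q a.+1 0; have := mixcoefSr q a 0.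
  by rewrite !mixcoef_small; nia.
(* These recurrences reduce every coefficient to those of (1+x)^q (1-x)^(-a-2) at x^j, x^(j-1),
   x^(j-2), where j = [n.+2]; [dh] and [qE] then give the goal. *)
have := mixcoefSl q a.+1 n.+1; have := mixcoefSl q a.+2 n.+1.
have := mixcoefSl q a.+2 n.
have := mixcoefSr q a.+1 n.+1; have := mixcoefSr q a n.+1.
have := mixcoefSr q a.+1 n.
nia.
Qed.

Lemma mixcoef_double p m n :
  (mixcoef p m n + mixcoef p.+1 m.+1 n = 2 * mixcoef p m.+1 n)%N.
Proof.
case: n => [|n]; first by rewrite !mixcoef_small.
by rewrite mixcoefSl mixcoefSr; lia.
Qed.

Lemma prod_mixcoef a j :
  (\prod_(0 <= i < j) (2 * (2 * i + 1 + a)) =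
   j`! * mixcoef (j.*2 + a) a j)%N.
Proof.
elim: j a => [|j IHj] a; first by rewrite big_geq // mixcoef_small.
rewrite factS -mulnA mulnCA mixcoef_central big_nat_recl //.
rewrite mulnCA -IHj muln0 add0n add1n; congr (_ * _)%N.
(* Shifting [i] by one is the same as replacing [a] by [a.+2]. *)
by apply: eq_bigr => i _; lia.
Qed.

Lemma sum_bin_prod a N j :
  (\sum_(0 <= l < N.+1)
     'C(N, l) * \prod_(0 <= i < j) (2 * (2 * i + 1 + (a + l))) =
   2 ^ N * j`! * mixcoef (j.*2 + a) (N + a) j)%N.
Proof.
elim: N a => [|N IHN] a.
  by rewrite big_nat1 bin0 !mul1n addn0 prod_mixcoef.
pose P b := (\prod_(0 <= i < j) (2 * (2 * i + 1 + b)))%N.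
(* Pascal's rule for C(N+1,l) yields two sums over N, with shifts [a] and [a.+1]. *)
transitivity (\sum_(0 <= l < N.+1) 'C(N, l) * P (a + l) +
              \sum_(0 <= l < N.+1) 'C(N, l) * P (a.+1 + l))%N.
  rewrite big_nat_recl // [X in _ = (X + _)%N]big_nat_recl // !bin0 -addnA.
  congr (_ + _)%N.
  under eq_bigr => l _ do rewrite binS mulnDl -/(P _).
  rewrite big_split /= big_nat_recr //= bin_small // addn0; congr (_ + _)%N.
  by apply: eq_bigr => l _; rewrite addSnnS.
rewrite !IHN !addnS addSn expnSr -mulnDr mixcoef_double; ring.
Qed.

Lemma rising_oppn (F : fieldType) (n k : nat) :
  rising (- n%:R : F) k = (-1) ^+ k * (n ^_ k)%:R.
Proof.
elim: k => [|k IHk]; first by rewrite /rising big_geq // ffactn0 mulr1.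
rewrite /rising big_nat_recr //= -/(rising _ _) IHk ffactnSr exprSr natrM.
have [lekn|ltnk] := leqP k n; first by rewrite natrB //; ring.
by rewrite ffact_small // !(mul0r, mulr0).
Qed.

(** Times (j-k)! (M-j)!, both sides equal M! j!. This turns the quotient in the k-th hypergeometric
    term into a multichoose coefficient. *)
Lemma ffact_mul_ffact M j k : (k <= j)%N -> (j <= M)%N ->
  (M ^_ j * j ^_ k = j`! * 'C(M - k, j - k) * M ^_ k)%N.
Proof.
move=> lekj lejM.
have lekM := leq_trans lekj lejM.
have := bin_fact (leq_sub2r k lejM); rewrite subnBA // subnK // => binE.
have D_gt0 : (0 < (j - k)`! * (M - j)`!)%N by rewrite muln_gt0 !fact_gt0.
apply/eqP; rewrite -(eqn_pmul2r D_gt0); apply/eqP.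
transitivity (M`! * j`!)%N.
  by rewrite -(ffact_fact lejM) -(ffact_fact lekj); ring.
by rewrite -(ffact_fact lekM) -binE; ring.
Qed.

Lemma gauss2F1_mixcoef (N j : nat) : (0 < N)%N ->
  j`!%:R * 'C(N + j - 1, j)%:R *
    gauss2F1 j (- (2 * j%:R)) (- N%:R - j%:R + 1) (-1)
  = (j`! * mixcoef j.*2 N j)%:R :> rat.
Proof.
move=> N_gt0; set M := (N + j - 1)%N.
have -> : - N%:R - j%:R + 1 = - M%:R :> rat.
  by rewrite natrB ?natrD; [ring | lia].
rewrite -natrM -mul2n mulnC bin_ffact /gauss2F1 -natrM mulr_sumr /mixcoef.
rewrite big_distrr natr_sum; apply: eq_big_nat => k /andP[_ ltkj].
have lejM : (j <= M)%N by lia.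
(* The lower parameter is -M, and k <= j <= M (from [N_gt0]) keeps its rising factorials nonzero. *)
have Mk0 : (M ^_ k)%:R != 0 :> rat by rewrite pnatr_eq0 -lt0n ffact_gt0; lia.
have k0 : k`!%:R != 0 :> rat by rewrite pnatr_eq0 -lt0n fact_gt0.
have s0 : (-1) ^+ k != 0 :> rat by rewrite signr_eq0.
have s2 : (-1) ^+ k * (-1) ^+ k = 1 :> rat by rewrite -expr2 sqrr_sign.
rewrite !rising_oppn -(bin_ffact (2 * j)) /multichoose.
have -> : (N + (j - k)).-1 = (M - k)%N by lia.
have /(congr1 (fun n => n%:R : rat)) := ffact_mul_ffact M j k ltkj lejM.
rewrite !natrM => E.
(* Three rising factorials and z^k each carry (-1)^k; one cancels against the denominator, leaving a
   square. *)
transitivity ((-1) ^+ k * (-1) ^+ k * ((M ^_ j)%:R * (j ^_ k)%:R) *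
              'C(2 * j, k)%:R / (M ^_ k)%:R : rat).
  by field; rewrite k0 Mk0 s0.
by rewrite s2 E; field.
Qed.

Theorem theorem1 (N j : nat) (hN : (0 < N)%N) (hj : (0 < j)%N) :
  j`!%:R * 2 ^+ N * 'C(N + j - 1, j)%:R *
    gauss2F1 j (- (2 * j%:R)) (- N%:R - j%:R + 1) (-1)
  = \sum_(0 <= l < N.+1)
      'C(N, l)%:R * \prod_(0 <= i < j) (2 * (2 * i%:R + 1 + l%:R)) :> rat.
Proof.
transitivity ((2 ^ N * j`! * mixcoef (j.*2 + 0) (N + 0) j)%:R : rat).
  by rewrite !addn0 -mulnA natrM natrX -gauss2F1_mixcoef //; ring.
rewrite -sum_bin_prod natr_sum; apply: eq_bigr => l _.
rewrite natrM natr_prod; congr (_ * _); apply: eq_bigr => i _.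
by rewrite add0n; ring.
Qed.
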